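(* Let $\mathcal{B}$ be a finite 2-category and let $A,B,C$ be 0-cells of $\mathcal{B}$. There exists an isomorphism $$\sigma^B_X:\mathcal{L}(A,B)\circ X\Rightarrow X\circ\mathcal{L}(C,B),$$ natural in $X\in\mathcal{B}(C,A)$, such that $$\pi^{(A,B)}_Y\circ\mathrm{id}_X=(\mathrm{ev}_X\circ\mathrm{id}_{{}^*Y\circ Y\circ X})\,(\mathrm{id}_X\circ\pi^{(C,B)}_{Y\circ X})\,\sigma^B_X$$ for all $X\in\mathcal{B}(C,A)$ and $Y\in\mathcal{B}(A,B)$. With these maps, for any 0-cell $B$ the collection $\mathcal{A}d_B=((\mathcal{L}(A,B))_{A},\sigma^B)$, with $A$ running over all 0-cells, is an object of the center $Z(\mathcal{B})$.
   Context: Throughout, $\Bbbk$ is an algebraically closed field; all (hom-)categories are abelian $\Bbbk$-linear and all functors additive $\Bbbk$-linear. 2-categories are strict; $\circ$ is horizontal composition, juxtaposition is vertical composition, $I_A$ is the identity 1-cell of $A$. A left dual of $X\in\mathcal{B}(A,B)$ is a 1-cell ${}^*X\in\mathcal{B}(B,A)$ with 2-cells $\mathrm{ev}_X:X\circ{}^*X\to I_B$, $\mathrm{coev}_X:I_A\to{}^*X\circ X$ satisfying the two triangle identities; a right dual $X^*$ is defined similarly with $X^*\circ X\to I_A$, $I_B\to X\circ X^*$. $\mathcal{B}$ is rigid if every 1-cell has left and right duals. A finite category is one equivalent to finite-dimensional modules over a finite-dimensional $\Bbbk$-algebra. A finite 2-category is a rigid 2-category with all $\mathcal{B}(A,B)$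 finite and all $I_A$ simple in $\mathcal{B}(A,A)$. For 0-cells $A,B$, $\mathcal{L}(A,B)=\int_{X\in\mathcal{B}(A,B)}{}^*X\circ X\in\mathcal{B}(A,A)$ is the end of $(X,Y)\mapsto{}^*X\circ Y$ (which always exists), with universal dinatural transformation $\pi^{(A,B)}_X:\mathcal{L}(A,B)\to{}^*X\circ X$. In the displayed identity the canonical isomorphism ${}^*(Y\circ X)\simeq{}^*X\circ{}^*Y$ is suppressed. Center: objects of $Z(\mathcal{B})$ are pairs $(V,\sigma)$ with 1-cells $V_A\in\mathcal{B}(A,A)$ for each 0-cell $A$ and isomorphisms $\sigma_X:V_B\circ X\to X\circ V_A$ natural in $X\in\mathcal{B}(A,B)$, with $\sigma_{I_A}=\mathrm{id}_{V_A}$ and $\sigma_{X\circ Y}=(\mathrm{id}_X\circ\sigma_Y)(\sigma_X\circ\mathrm{id}_Y)$ for composable 1-cells $X,Y$. *)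

(* Defs.v *)
From HB Require Import structures.
From mathcomp Require Import all_boot all_algebra.
From mathcomp Require Import boolp.

Set Implicit Arguments.
Unset Strict Implicit.
Unset Printing Implicit Defensive.

Import GRing.Theory.
Local Open Scope ring_scope.

Record lin_category (k : fieldType) := LinCategory {
  lc_ob :> Type;
  mor : lc_ob -> lc_ob -> lmodType k;
  idm : forall X : lc_ob, mor X X;
  vcomp : forall X Y Z : lc_ob, mor Y Z -> mor X Y -> mor X Z;
  vcompA : forall (X Y Z W : lc_ob) (h : mor Z W) (g : mor Y Z) (f : mor X Y),
    vcomp h (vcomp g f) = vcomp (vcomp h g) f;
  vcomp1m : forall (X Y : lc_ob) (f : mor X Y), vcomp (idm Y) f = f;
  vcompm1 : forall (X Y : lc_ob) (f : mor X Y), vcomp f (idm X) = f;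
  vcomp_linearr : forall (X Y Z : lc_ob) (g : mor Y Z),
    linear (fun f : mor X Y => vcomp g f);
  vcomp_linearl : forall (X Y Z : lc_ob) (f : mor X Y),
    linear (fun g : mor Y Z => vcomp g f)
}.

Arguments mor {k l} X Y.
Arguments idm {k l} X.
Arguments vcomp {k l X Y Z} g f.

Notation "g \v f" := (vcomp g f) (at level 45, left associativity).

Definition is_iso (k : fieldType) (C : lin_category k) (X Y : C)
    (f : mor X Y) : Prop :=
  exists g : mor Y X, g \v f = idm X /\ f \v g = idm Y.

Definition is_mono (k : fieldType) (C : lin_category k) (X Y : C)
    (f : mor X Y) : Prop :=
  forall (W : C) (u v : mor W X), f \v u = f \v v -> u = v.

Definition is_epi (k : fieldType) (C : lin_category k) (X Y : C)
    (f : mor X Y) : Prop :=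
  forall (W : C) (u v : mor Y W), u \v f = v \v f -> u = v.

Definition is_zero (k : fieldType) (C : lin_category k) (Z : C) : Prop :=
  forall X : C, (forall f : mor X Z, f = 0) /\ (forall f : mor Z X, f = 0).

Definition is_biproduct (k : fieldType) (C : lin_category k) (X Y P : C)
    (i1 : mor X P) (i2 : mor Y P) (p1 : mor P X) (p2 : mor P Y) : Prop :=
  [/\ p1 \v i1 = idm X, p2 \v i2 = idm Y, p1 \v i2 = 0, p2 \v i1 = 0
    & i1 \v p1 + i2 \v p2 = idm P].

Definition is_kernel (k : fieldType) (C : lin_category k) (K X Y : C)
    (i : mor K X) (f : mor X Y) : Prop :=
  f \v i = 0 /\
  forall (W : C) (g : mor W X), f \v g = 0 -> exists! u : mor W K, i \v u = g.

Definition is_cokernel (k : fieldType) (C : lin_category k) (X Y Q : C)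
    (p : mor Y Q) (f : mor X Y) : Prop :=
  p \v f = 0 /\
  forall (W : C) (g : mor Y W), g \v f = 0 -> exists! u : mor Q W, u \v p = g.

Record abelian_category (k : fieldType) (C : lin_category k) : Prop := {
  ab_zero : exists Z : C, is_zero Z;
  ab_biproduct : forall X Y : C, exists (P : C) (i1 : mor X P) (i2 : mor Y P)
    (p1 : mor P X) (p2 : mor P Y), is_biproduct i1 i2 p1 p2;
  ab_kernel : forall (X Y : C) (f : mor X Y),
    exists (K : C) (i : mor K X), is_kernel i f;
  ab_cokernel : forall (X Y : C) (f : mor X Y),
    exists (Q : C) (p : mor Y Q), is_cokernel p f;
  ab_mono : forall (X Y : C) (f : mor X Y), is_mono f ->
    exists (Z : C) (g : mor Y Z), is_kernel f g;
  ab_epi : forall (X Y : C) (f : mor X Y), is_epi f ->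
    exists (Z : C) (g : mor Z X), is_cokernel f g
}.

Definition is_simple (k : fieldType) (C : lin_category k) (X : C) : Prop :=
  ~ is_zero X /\
  forall (Y : C) (i : mor Y X), is_mono i -> is_zero Y \/ is_iso i.

Record lin_functor (k : fieldType) (C D : lin_category k) := LinFunctor {
  fob :> C -> D;
  fmap : forall X Y : C, mor X Y -> mor (fob X) (fob Y);
  fmap_linear : forall X Y : C, linear (@fmap X Y);
  fmap_id : forall X : C, fmap (idm X) = idm (fob X);
  fmap_comp : forall (X Y Z : C) (g : mor Y Z) (f : mor X Y),
    fmap (g \v f) = fmap g \v fmap f
}.

Definition functor_id (k : fieldType) (C : lin_category k) : lin_functor C C :=
  @LinFunctor k C C (fun X => X) (fun X Y f => f)
    (fun _ _ _ _ _ => erefl) (fun _ => erefl) (fun _ _ _ _ _ => erefl).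

Program Definition functor_comp (k : fieldType) (C D E : lin_category k)
    (G : lin_functor D E) (F : lin_functor C D) : lin_functor C E :=
  @LinFunctor k C E (fun X => G (F X)) (fun X Y f => fmap G (fmap F f)) _ _ _.
Next Obligation. by move=> a f g /=; rewrite !fmap_linear. Qed.
Next Obligation. by rewrite !fmap_id. Qed.
Next Obligation. by rewrite !fmap_comp. Qed.

Definition naturally_isomorphic (k : fieldType) (C D : lin_category k)
    (F G : lin_functor C D) : Prop :=
  exists2 t : (forall X : C, mor (F X) (G X)),
    forall (X Y : C) (f : mor X Y), fmap G f \v t X = t Y \v fmap F f
    & forall X : C, is_iso (t X).

Definition equivalent_categories (k : fieldType) (C D : lin_category k) : Prop :=
  exists (F : lin_functor C D) (G : lin_functor D C),
    naturally_isomorphic (functor_comp G F) (functor_id C) /\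
    naturally_isomorphic (functor_comp F G) (functor_id D).

(* MathComp's [algType] excludes the zero algebra, whose category of modules
   (the zero category) has to be allowed as a hom-category. *)
Record fd_algebra (k : fieldType) := FdAlgebra {
  fa_car :> vectType k;
  fa_one : fa_car;
  fa_mul : fa_car -> fa_car -> fa_car;
  fa_mulA : associative fa_mul;
  fa_mul1 : left_id fa_one fa_mul;
  fa_mulr1 : right_id fa_one fa_mul;
  fa_mul_linearr : forall a : fa_car, linear (fun b : fa_car => fa_mul a b);
  fa_mul_linearl : forall b : fa_car, linear (fun a : fa_car => fa_mul a b)
}.

Record fd_module (k : fieldType) (A : fd_algebra k) := FdModule {
  fm_car :> vectType k;
  fm_act : A -> fm_car -> fm_car;
  fm_actA : forall (a b : A) (x : fm_car),
    fm_act a (fm_act b x) = fm_act (fa_mul a b) x;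
  fm_act1 : forall x : fm_car, fm_act (fa_one A) x = x;
  fm_act_linearr : forall a : A, linear (fun x : fm_car => fm_act a x);
  fm_act_linearl : forall x : fm_car, linear (fun a : A => fm_act a x)
}.

Definition equivariant (k : fieldType) (A : fd_algebra k) (M N : fd_module A) :
    {pred 'Hom(M, N)} :=
  fun f => `[< forall (a : A) (x : M), f (fm_act a x) = fm_act a (f x) >].

Lemma equivariant_submod (k : fieldType) (A : fd_algebra k)
    (M N : fd_module A) : submod_closed (@equivariant k A M N).
Proof.
split=> [|c f g /asboolP hf /asboolP hg]; apply/asboolP => a x.
  rewrite !zero_lfunE; have /esym := fm_act_linearr a (-1) (0 : N) 0.
  by rewrite scaler0 addr0 scaleN1r addNr.
by rewrite !add_lfunE !scale_lfunE hf hg fm_act_linearr.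
Qed.

HB.instance Definition _ (k : fieldType) (A : fd_algebra k)
    (M N : fd_module A) :=
  GRing.isSubmodClosed.Build k 'Hom(M, N) (@equivariant k A M N)
    (@equivariant_submod k A M N).

Record module_hom (k : fieldType) (A : fd_algebra k) (M N : fd_module A) :=
  ModuleHom {
    mh_val :> 'Hom(M, N);
    mh_valP : mh_val \in @equivariant k A M N }.

HB.instance Definition _ (k : fieldType) (A : fd_algebra k)
    (M N : fd_module A) := [isSub for @mh_val k A M N].
HB.instance Definition _ (k : fieldType) (A : fd_algebra k)
    (M N : fd_module A) := [Choice of module_hom M N by <:].
HB.instance Definition _ (k : fieldType) (A : fd_algebra k)
    (M N : fd_module A) := [SubChoice_isSubLmodule of module_hom M N by <:].

Lemma module_hom_id_subproof (k : fieldType) (A : fd_algebra k)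
    (M : fd_module A) : \1%VF \in @equivariant k A M M.
Proof. by apply/asboolP => a x; rewrite !id_lfunE. Qed.

Definition module_hom_id (k : fieldType) (A : fd_algebra k)
    (M : fd_module A) : module_hom M M :=
  ModuleHom (module_hom_id_subproof M).

Lemma module_hom_comp_subproof (k : fieldType) (A : fd_algebra k)
    (M N P : fd_module A) (g : module_hom N P) (f : module_hom M N) :
  (mh_val g \o mh_val f)%VF \in @equivariant k A M P.
Proof.
apply/asboolP => a x; rewrite !comp_lfunE.
by move: (mh_valP f) (mh_valP g) => /asboolP-> /asboolP->.
Qed.

Definition module_hom_comp (k : fieldType) (A : fd_algebra k)
    (M N P : fd_module A) (g : module_hom N P) (f : module_hom M N) :
    module_hom M P :=
  ModuleHom (module_hom_comp_subproof g f).

Program Definition module_category (k : fieldType) (A : fd_algebra k) :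
    lin_category k :=
  @LinCategory k (fd_module A) (fun M N => module_hom M N)
    (@module_hom_id k A) (@module_hom_comp k A) _ _ _ _ _.
Next Obligation. by apply: val_inj; rewrite /= comp_lfunA. Qed.
Next Obligation. by apply: val_inj; rewrite /= comp_lfun1l. Qed.
Next Obligation. by apply: val_inj; rewrite /= comp_lfun1r. Qed.
Next Obligation.
by move=> c f f'; apply: val_inj; rewrite /= comp_lfunDr comp_lfunZr.
Qed.
Next Obligation.
by move=> c g g'; apply: val_inj; rewrite /= comp_lfunDl comp_lfunZl.
Qed.

Definition finite_category (k : fieldType) (C : lin_category k) : Prop :=
  exists A : fd_algebra k, equivalent_categories C (module_category A).

(* The 2-cell X => Y given by an equality of 1-cells. *)
Definition eqcell (k : fieldType) (C : lin_category k) (X Y : C) (e : X = Y) :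
    mor X Y :=
  match e in _ = Z return mor X Z with erefl => idm X end.

(* Horizontal composition is strictly associative and unital: on 1-cells these
   are equalities, on 2-cells they are equalities up to the transports [eqcell]
   along the former. *)
Record two_category (k : fieldType) := TwoCategory {
  cell0 :> Type;
  cell1 : cell0 -> cell0 -> lin_category k;
  cell1_abelian : forall A B : cell0, abelian_category (cell1 A B);
  unit1 : forall A : cell0, cell1 A A;
  comp1 : forall A B C : cell0, cell1 B C -> cell1 A B -> cell1 A C;
  comp2 : forall (A B C : cell0) (Y Y' : cell1 B C) (X X' : cell1 A B),
    mor Y Y' -> mor X X' -> mor (comp1 Y X) (comp1 Y' X');
  comp2_id : forall (A B C : cell0) (Y : cell1 B C) (X : cell1 A B),
    comp2 (idm Y) (idm X) = idm (comp1 Y X);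
  comp2_vcomp : forall (A B C : cell0)
    (Y Y' Y'' : cell1 B C) (X X' X'' : cell1 A B)
    (b' : mor Y' Y'') (b : mor Y Y') (a' : mor X' X'') (a : mor X X'),
    comp2 (b' \v b) (a' \v a) = comp2 b' a' \v comp2 b a;
  comp2_linearr : forall (A B C : cell0) (Y Y' : cell1 B C) (X X' : cell1 A B)
    (b : mor Y Y'), linear (fun a : mor X X' => comp2 b a);
  comp2_linearl : forall (A B C : cell0) (Y Y' : cell1 B C) (X X' : cell1 A B)
    (a : mor X X'), linear (fun b : mor Y Y' => comp2 b a);
  comp1A : forall (A B C D : cell0)
    (Z : cell1 C D) (Y : cell1 B C) (X : cell1 A B),
    comp1 Z (comp1 Y X) = comp1 (comp1 Z Y) X;
  comp11m : forall (A B : cell0) (X : cell1 A B), comp1 (unit1 B) X = X;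
  comp1m1 : forall (A B : cell0) (X : cell1 A B), comp1 X (unit1 A) = X;
  comp2A : forall (A B C D : cell0) (Z Z' : cell1 C D) (Y Y' : cell1 B C)
    (X X' : cell1 A B) (c : mor Z Z') (b : mor Y Y') (a : mor X X'),
    eqcell (comp1A Z' Y' X') \v comp2 c (comp2 b a)
      = comp2 (comp2 c b) a \v eqcell (comp1A Z Y X);
  comp21m : forall (A B : cell0) (X X' : cell1 A B) (a : mor X X'),
    eqcell (comp11m X') \v comp2 (idm (unit1 B)) a = a \v eqcell (comp11m X);
  comp2m1 : forall (A B : cell0) (X X' : cell1 A B) (a : mor X X'),
    eqcell (comp1m1 X') \v comp2 a (idm (unit1 A)) = a \v eqcell (comp1m1 X)
}.

Arguments cell1 {k} t A B.
Arguments unit1 {k t} A.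
Arguments comp1 {k t A B C} Y X.
Arguments comp2 {k t A B C Y Y' X X'} b a.
Arguments comp1A {k t A B C D} Z Y X.
Arguments comp11m {k t A B} X.
Arguments comp1m1 {k t A B} X.

Notation "Y \o1 X" := (comp1 Y X) (at level 40, left associativity).
Notation "b \o2 a" := (comp2 b a) (at level 40, left associativity).

(* ev and coev exhibit D as a left dual of X; equivalently, X as a right dual
   of D. *)
Definition is_left_dual (k : fieldType) (T : two_category k) (A B : T)
    (X : cell1 T A B) (D : cell1 T B A)
    (ev : mor (X \o1 D) (unit1 B)) (coev : mor (unit1 A) (D \o1 X)) : Prop :=
  eqcell (comp11m X) \v (ev \o2 idm X) \v eqcell (comp1A X D X)
    \v (idm X \o2 coev) \v eqcell (esym (comp1m1 X)) = idm X
  /\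
  eqcell (comp1m1 D) \v (idm D \o2 ev) \v eqcell (esym (comp1A D X D))
    \v (coev \o2 idm D) \v eqcell (esym (comp11m D)) = idm D.

Record left_dual (k : fieldType) (T : two_category k) (A B : T)
    (X : cell1 T A B) := LeftDual {
  ldual :> cell1 T B A;
  ev : mor (X \o1 ldual) (unit1 B);
  coev : mor (unit1 A) (ldual \o1 X);
  left_dualP : is_left_dual ev coev
}.

Arguments ev {k T A B X} l.
Arguments coev {k T A B X} l.

Record right_dual (k : fieldType) (T : two_category k) (A B : T)
    (X : cell1 T A B) := RightDual {
  rdual :> cell1 T B A;
  rdual_ev : mor (rdual \o1 X) (unit1 A);
  rdual_coev : mor (unit1 B) (X \o1 rdual);
  right_dualP : is_left_dual rdual_ev rdual_coev
}.

Definition rigid (k : fieldType) (T : two_category k) : Prop :=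
  forall (A B : T) (X : cell1 T A B),
    inhabited (left_dual X) /\ inhabited (right_dual X).

Record finite_two_category (k : fieldType) (T : two_category k) : Prop := {
  f2_rigid : rigid T;
  f2_finite : forall A B : T, finite_category (cell1 T A B);
  f2_simple : forall A : T, is_simple (unit1 A)
}.

(* The 2-cell from *Y to *X induced by f : X => Y. *)
Definition ldual_map (k : fieldType) (T : two_category k) (A B : T)
    (X Y : cell1 T A B) (dX : left_dual X) (dY : left_dual Y) (f : mor X Y) :
    mor dY dX :=
  eqcell (comp1m1 dX) \v (idm dX \o2 ev dY) \v eqcell (esym (comp1A dX Y dY))
    \v ((idm dX \o2 f) \o2 idm dY) \v (coev dX \o2 idm dY)
    \v eqcell (esym (comp11m dY)).

(* The coevaluation making *X o *Y a left dual of Y o X. *)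
Definition coev_comp (k : fieldType) (T : two_category k) (A B C : T)
    (Y : cell1 T B C) (X : cell1 T A B) (dY : left_dual Y) (dX : left_dual X) :
    mor (unit1 A) ((dX \o1 dY) \o1 (Y \o1 X)) :=
  eqcell (etrans (congr1 (comp1 dX) (esym (comp1A dY Y X)))
                 (comp1A dX dY (Y \o1 X)))
    \v (idm dX \o2 (coev dY \o2 idm X))
    \v eqcell (congr1 (comp1 dX) (esym (comp11m X)))
    \v coev dX.

(* The canonical 2-cell *(Y o X) => *X o *Y between two left duals of Y o X. *)
Definition ldual_comp (k : fieldType) (T : two_category k) (A B C : T)
    (Y : cell1 T B C) (X : cell1 T A B) (dY : left_dual Y) (dX : left_dual X)
    (dYX : left_dual (Y \o1 X)) : mor dYX (dX \o1 dY) :=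
  eqcell (comp1m1 (dX \o1 dY)) \v (idm (dX \o1 dY) \o2 ev dYX)
    \v eqcell (esym (comp1A (dX \o1 dY) (Y \o1 X) dYX))
    \v (coev_comp dY dX \o2 idm dYX)
    \v eqcell (esym (comp11m dYX)).

Definition left_duals (k : fieldType) (T : two_category k) : Type :=
  forall (A B : T) (X : cell1 T A B), left_dual X.

Definition is_wedge (k : fieldType) (T : two_category k) (ld : left_duals T)
    (A B : T) (W : cell1 T A A)
    (d : forall X : cell1 T A B, mor W (ld A B X \o1 X)) : Prop :=
  forall (X Y : cell1 T A B) (f : mor X Y),
    (idm (ld A B X) \o2 f) \v d X
      = (ldual_map (ld A B X) (ld A B Y) f \o2 idm Y) \v d Y.

Record dual_end (k : fieldType) (T : two_category k) (ld : left_duals T)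
    (A B : T) := DualEnd {
  end_ob :> cell1 T A A;
  end_pr : forall X : cell1 T A B, mor end_ob (ld A B X \o1 X);
  end_wedge : is_wedge end_pr;
  end_universal : forall (W : cell1 T A A)
    (d : forall X : cell1 T A B, mor W (ld A B X \o1 X)), is_wedge d ->
    exists! u : mor W end_ob, forall X : cell1 T A B, end_pr X \v u = d X
}.

Arguments end_pr {k T ld A B} d0 X.

Record is_center_object (k : fieldType) (T : two_category k)
    (V : forall A : T, cell1 T A A)
    (sigma : forall (A B : T) (X : cell1 T A B), mor (V B \o1 X) (X \o1 V A)) :
    Prop := {
  center_iso : forall (A B : T) (X : cell1 T A B), is_iso (sigma A B X);
  center_natural : forall (A B : T) (X X' : cell1 T A B) (f : mor X X'),
    (f \o2 idm (V A)) \v sigma A B X = sigma A B X' \v (idm (V B) \o2 f);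
  center_unit : forall A : T,
    sigma A A (unit1 A) = eqcell (etrans (comp1m1 (V A)) (esym (comp11m (V A))));
  center_comp : forall (A B C : T) (X : cell1 T B C) (Y : cell1 T A B),
    sigma A C (X \o1 Y) =
      eqcell (comp1A X Y (V A)) \v (idm X \o2 sigma A B Y)
        \v eqcell (esym (comp1A X (V B) Y)) \v (sigma B C X \o2 idm Y)
        \v eqcell (comp1A (V C) X Y)
}.

Arguments is_center_object {k T} V sigma.

Lemma rebracket (k : fieldType) (T : two_category k) (A B C D : T)
    (X : cell1 T A B) (X' : cell1 T B A) (Y' : cell1 T C B)
    (Y : cell1 T B C) (W : cell1 T D B) :
  X \o1 ((X' \o1 Y') \o1 (Y \o1 W)) = (X \o1 X') \o1 ((Y' \o1 Y) \o1 W).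
Proof. by rewrite !comp1A. Qed.

(* (ev_X o id) (id_X o pi^{(C,B)}_{Y o X}), as a 2-cell
   X o L(C,B) => *Y o Y o X, with the canonical 2-cell
   *(Y o X) => *X o *Y inserted. *)
Definition ev_end_pr (k : fieldType) (T : two_category k) (ld : left_duals T)
    (A B C : T) (LCB : dual_end ld C B) (X : cell1 T C A) (Y : cell1 T A B) :
    mor (X \o1 LCB) ((ld A B Y \o1 Y) \o1 X) :=
  eqcell (comp11m ((ld A B Y \o1 Y) \o1 X))
    \v (ev (ld C A X) \o2 idm ((ld A B Y \o1 Y) \o1 X))
    \v eqcell (rebracket X (ld C A X) (ld A B Y) Y X)
    \v (idm X \o2 (ldual_comp (ld A B Y) (ld C A X) (ld C B (Y \o1 X))
                     \o2 idm (Y \o1 X)))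
    \v (idm X \o2 end_pr LCB (Y \o1 X)).

(* Main.v *)
(* Under the adjunction between X o - and *X o -, a wedge W => *Y o Y becomes a
   family Y o W => Y, and the wedge condition becomes naturality in Y.  Hence
   L(A,B) carries the universal natural action a_Y : Y o L(A,B) => Y, and by the
   adjunction between - o X and - o *X the 1-cell L(A,B) o X carries the
   universal natural family Y o W => Y o X.  The half braiding
   t_X : X o L(C,B) => L(A,B) o X is the one with (a_Y o X)(Y o t_X) = a_{Y o X};
   universality makes it natural, unital and multiplicative in X, so it is
   invertible because X has a right dual, and sigma is its inverse. *)
Require Import Defs.
From HB Require Import structures.
From mathcomp Require Import all_boot all_algebra.
From mathcomp Require Import boolp.

Set Implicit Arguments.
Unset Strict Implicit.
Unset Printing Implicit Defensive.

Import GRing.Theory.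
Local Open Scope ring_scope.

(** * Bundled 2-cells and their vertical composition *)

Section Arrows.
Variables (k : fieldType) (C : lin_category k).

(* Bundling a 2-cell with its boundary turns the strict associativity and unit
   laws of the 2-category into Leibniz equalities, without [eqcell]. *)
Record arrow := Arrow { src : C; tgt : C; cell : mor src tgt }.

(* 0 when [f] and [g] are not composable, which keeps [varrowA] unconditional. *)
Definition varrow (g f : arrow) : arrow :=
  Arrow (match pselect (tgt f = src g) with
         | left e => cell g \v eqcell e \v cell f
         | right _ => 0
         end).

Lemma eqcell_refl (X : C) (e : X = X) : eqcell e = idm X.
Proof. by rewrite (Prop_irrelevance e erefl). Qed.

(** Equality of bundled cells gives equality up to transport along equations of the boundary; here
    these are loops at [X] and [Y], so by proof irrelevance the transports are identities. *)
Lemma Arrow_inj (X Y : C) (f g : mor X Y) : Arrow f = Arrow g -> f = g.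
Proof.
have H (a b : arrow) (p : a = b) :
    eqcell (congr1 tgt p) \v cell a = cell b \v eqcell (congr1 src p).
  by case: b / p; rewrite vcomp1m vcompm1.
by move=> p; have := H _ _ p; rewrite !eqcell_refl vcomp1m vcompm1.
Qed.

Lemma Arrow_eq (X Y X' Y' : C) (f : mor X Y) (g : mor X' Y')
    (eX : X = X') (eY : Y = Y') :
  eqcell eY \v f = g \v eqcell eX -> Arrow f = Arrow g.
Proof.
by case: X' / eX g => g; case: Y' / eY g => g; rewrite vcomp1m vcompm1 => ->.
Qed.

Lemma Arrow_eqcell (X Y : C) (e : X = Y) : Arrow (eqcell e) = Arrow (idm X).
Proof. by case: Y / e. Qed.

Lemma Arrow_vcomp (X Y Z : C) (g : mor Y Z) (f : mor X Y) :
  Arrow (g \v f) = varrow (Arrow g) (Arrow f).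
Proof.
rewrite /varrow /=; case: pselect => // e.
by rewrite eqcell_refl vcompm1.
Qed.

Lemma vcomp0r (X Y Z : C) (g : mor Y Z) : g \v (0 : mor X Y) = 0.
Proof.
have := vcomp_linearr g (-1) (0 : mor X Y) 0.
by rewrite scaler0 addr0 scaleN1r addNr.
Qed.

Lemma vcomp0l (X Y Z : C) (f : mor X Y) : (0 : mor Y Z) \v f = 0.
Proof.
have := vcomp_linearl f (-1) (0 : mor Y Z) 0.
by rewrite scaler0 addr0 scaleN1r addNr.
Qed.

Lemma varrowA (h g f : arrow) : varrow h (varrow g f) = varrow (varrow h g) f.
Proof.
rewrite /varrow /=; congr Arrow.
case: (pselect (tgt f = src g)) => [e|_]; case: (pselect (tgt g = src h)) => [e'|_];
  by rewrite ?vcomp0r ?vcomp0l ?vcompA.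
Qed.

Lemma varrow_idl (X : C) (f : arrow) : tgt f = X -> varrow (Arrow (idm X)) f = f.
Proof. by case: f => Y Z f /= <-; rewrite -Arrow_vcomp vcomp1m. Qed.

Lemma varrow_idr (X : C) (f : arrow) : src f = X -> varrow f (Arrow (idm X)) = f.
Proof. by case: f => Y Z f /= <-; rewrite -Arrow_vcomp vcompm1. Qed.

End Arrows.

Notation "⟦ f ⟧" := (Arrow f) (at level 0, f at level 99, format "⟦ f ⟧").
Notation "g \V f" := (varrow g f) (at level 45, left associativity).

(** * Horizontal composition and whiskering of bundled 2-cells *)

Definition harrow (k : fieldType) (T : two_category k) (A B C : T)
    (b : arrow (cell1 T B C)) (a : arrow (cell1 T A B)) : arrow (cell1 T A C) :=
  ⟦cell b \o2 cell a⟧.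

Definition lwhisk (k : fieldType) (T : two_category k) (A B C : T)
    (Y : cell1 T B C) (a : arrow (cell1 T A B)) := harrow ⟦idm Y⟧ a.

Definition rwhisk (k : fieldType) (T : two_category k) (A B C : T)
    (b : arrow (cell1 T B C)) (X : cell1 T A B) := harrow b ⟦idm X⟧.

Notation "Y ◁ a" := (lwhisk Y a) (at level 41, right associativity).
Notation "b ▷ X" := (rwhisk b X) (at level 40, left associativity).

Section Horizontal.
Variables (k : fieldType) (T : two_category k).

Lemma harrowA (A B C D : T) (c : arrow (cell1 T C D)) (b : arrow (cell1 T B C))
    (a : arrow (cell1 T A B)) : harrow c (harrow b a) = harrow (harrow c b) a.
Proof. by apply: Arrow_eq (comp2A _ _ _). Qed.

Lemma harrow_id (A B C : T) (Y : cell1 T B C) (X : cell1 T A B) :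
  harrow ⟦idm Y⟧ ⟦idm X⟧ = ⟦idm (Y \o1 X)⟧.
Proof. by rewrite /harrow /= comp2_id. Qed.

Lemma harrow_varrow (A B C : T) (b' b : arrow (cell1 T B C))
    (a' a : arrow (cell1 T A B)) : tgt b = src b' -> tgt a = src a' ->
  harrow (b' \V b) (a' \V a) = harrow b' a' \V harrow b a.
Proof.
case: b b' a a' => [Y Y' b] [? Y'' b'] [X X' a] [? X'' a'] /=.
move=> e e'; case: _ / e b'; case: _ / e' a' => a' b'.
by rewrite -!Arrow_vcomp /harrow /= comp2_vcomp.
Qed.

Lemma lwhisk_comp (A B C D : T) (Z : cell1 T C D) (Y : cell1 T B C)
    (a : arrow (cell1 T A B)) : Z ◁ Y ◁ a = (Z \o1 Y) ◁ a.
Proof. by rewrite /lwhisk harrowA harrow_id. Qed.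

Lemma rwhisk_comp (A B C D : T) (c : arrow (cell1 T C D)) (Y : cell1 T B C)
    (X : cell1 T A B) : c ▷ Y ▷ X = c ▷ (Y \o1 X).
Proof. by rewrite /rwhisk -harrowA harrow_id. Qed.

Lemma lrwhisk (A B C D : T) (Z : cell1 T C D) (b : arrow (cell1 T B C))
    (X : cell1 T A B) : Z ◁ (b ▷ X) = (Z ◁ b) ▷ X.
Proof. exact: harrowA. Qed.

Lemma lwhisk1 (A B : T) (a : arrow (cell1 T A B)) : unit1 B ◁ a = a.
Proof. by case: a => X X' a; apply: Arrow_eq (comp21m _). Qed.

Lemma rwhisk1 (A B : T) (a : arrow (cell1 T A B)) : a ▷ unit1 A = a.
Proof. by case: a => X X' a; apply: Arrow_eq (comp2m1 _). Qed.

Lemma lwhisk_id (A B C : T) (Y : cell1 T B C) (X : cell1 T A B) :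
  Y ◁ ⟦idm X⟧ = ⟦idm (Y \o1 X)⟧.
Proof. exact: harrow_id. Qed.

Lemma rwhisk_id (A B C : T) (Y : cell1 T B C) (X : cell1 T A B) :
  ⟦idm Y⟧ ▷ X = ⟦idm (Y \o1 X)⟧.
Proof. exact: harrow_id. Qed.

Lemma lwhisk_varrow (A B C : T) (Y : cell1 T B C) (a' a : arrow (cell1 T A B)) :
  tgt a = src a' -> Y ◁ (a' \V a) = (Y ◁ a') \V (Y ◁ a).
Proof. by move=> e; rewrite -harrow_varrow // varrow_idl. Qed.

Lemma rwhisk_varrow (A B C : T) (b' b : arrow (cell1 T B C)) (X : cell1 T A B) :
  tgt b = src b' -> (b' \V b) ▷ X = (b' ▷ X) \V (b ▷ X).
Proof. by move=> e; rewrite -harrow_varrow // varrow_idl. Qed.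

Lemma exchange (A B C : T) (Y Y' : cell1 T B C) (X X' : cell1 T A B)
    (b : mor Y Y') (a : mor X X') :
  (⟦b⟧ ▷ X') \V (Y ◁ ⟦a⟧) = (Y' ◁ ⟦a⟧) \V (⟦b⟧ ▷ X).
Proof. by rewrite -!harrow_varrow // !varrow_idl // !varrow_idr. Qed.

End Horizontal.

Ltac eq_cell1 := by rewrite /= ?comp1A ?comp11m ?comp1m1.

(** * Triangle identities and mates *)

Section Mates.
Variables (k : fieldType) (T : two_category k).

(* Qed-opaque, so that rewriting with [Arrow_vcomp] cannot unfold [of_arrow]. *)
Lemma of_arrow_subproof (C : lin_category k) (a : arrow C) (X Y : C) :
  src a = X -> tgt a = Y -> {f : mor X Y | ⟦f⟧ = a}.
Proof.
move=> eX eY; exists (eqcell eY \v cell a \v eqcell (esym eX)).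
by rewrite !Arrow_vcomp !Arrow_eqcell varrow_idl // varrow_idr //; case: (a) eX.
Qed.

Definition of_arrow (C : lin_category k) (a : arrow C) (X Y : C)
    (eX : src a = X) (eY : tgt a = Y) : mor X Y := sval (of_arrow_subproof eX eY).

Lemma Arrow_of_arrow (C : lin_category k) (a : arrow C) (X Y : C)
    (eX : src a = X) (eY : tgt a = Y) : ⟦of_arrow eX eY⟧ = a.
Proof. exact: svalP (of_arrow_subproof eX eY). Qed.

Lemma Arrow_lwhisk (A B C : T) (Y : cell1 T B C) (X X' : cell1 T A B)
  (a : mor X X') : ⟦idm Y \o2 a⟧ = Y ◁ ⟦a⟧.
Proof. by []. Qed.

Lemma Arrow_rwhisk (A B C : T) (Y Y' : cell1 T B C) (X : cell1 T A B)
  (b : mor Y Y') : ⟦b \o2 idm X⟧ = ⟦b⟧ ▷ X.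
Proof. by []. Qed.

Section Zigzag.
Variables (A B : T) (X : cell1 T A B) (D : cell1 T B A).
Variables (e : mor (X \o1 D) (unit1 B)) (c : mor (unit1 A) (D \o1 X)).
Hypothesis dualP : is_left_dual e c.

Lemma zigzag1 : (⟦e⟧ ▷ X) \V (X ◁ ⟦c⟧) = ⟦idm X⟧.
Proof.
have [/(congr1 (@Arrow _ _ _ _)) <- _] := dualP.
rewrite !Arrow_vcomp !Arrow_eqcell !Arrow_lwhisk !Arrow_rwhisk.
by rewrite varrow_idl ?(varrow_idr (X := X)) ?varrow_idr //; eq_cell1.
Qed.

Lemma zigzag2 : (D ◁ ⟦e⟧) \V (⟦c⟧ ▷ D) = ⟦idm D⟧.
Proof.
have [_ /(congr1 (@Arrow _ _ _ _)) <-] := dualP.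
rewrite !Arrow_vcomp !Arrow_eqcell !Arrow_lwhisk !Arrow_rwhisk.
by rewrite varrow_idl ?(varrow_idr (X := D)) ?varrow_idr //; eq_cell1.
Qed.

End Zigzag.

Section Adjunction.
Variables (A B : T) (X : cell1 T A B) (D : cell1 T B A).
Variables (e : mor (X \o1 D) (unit1 B)) (c : mor (unit1 A) (D \o1 X)).
Hypothesis e_c_zigzag1 : (⟦e⟧ ▷ X) \V (X ◁ ⟦c⟧) = ⟦idm X⟧.
Hypothesis e_c_zigzag2 : (D ◁ ⟦e⟧) \V (⟦c⟧ ▷ D) = ⟦idm D⟧.

(** One round trip of the bijection between 2-cells [X \o1 W] to [V] and [W] to [D \o1 V]:
    [exchange] brings [e] next to [c], where they cancel. *)
Lemma lmateK (C : T) (W : cell1 T C A) (V : cell1 T C B) (g : mor (X \o1 W) V) :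
  (⟦e⟧ ▷ V) \V (X ◁ ((D ◁ ⟦g⟧) \V (⟦c⟧ ▷ W))) = ⟦g⟧.
Proof.
rewrite lwhisk_varrow; last by eq_cell1.
rewrite varrowA lwhisk_comp exchange lwhisk1 -varrowA -rwhisk_comp lrwhisk.
rewrite -rwhisk_varrow; last by eq_cell1.
by rewrite e_c_zigzag1 rwhisk_id varrow_idr.
Qed.

Lemma lunmateK (C : T) (W : cell1 T C A) (V : cell1 T C B) (h : mor W (D \o1 V)) :
  (D ◁ ((⟦e⟧ ▷ V) \V (X ◁ ⟦h⟧))) \V (⟦c⟧ ▷ W) = ⟦h⟧.
Proof.
rewrite lwhisk_varrow; last by eq_cell1.
rewrite -varrowA lwhisk_comp -exchange lwhisk1 varrowA -rwhisk_comp lrwhisk.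
rewrite -rwhisk_varrow; last by eq_cell1.
by rewrite e_c_zigzag2 rwhisk_id varrow_idl.
Qed.

(** The mirror adjunction: 2-cells [V] to [W \o1 X] correspond to 2-cells [V \o1 D] to [W]. *)
Lemma rmateK (C : T) (W : cell1 T B C) (V : cell1 T A C) (g : mor V (W \o1 X)) :
  (((W ◁ ⟦e⟧) \V (⟦g⟧ ▷ D)) ▷ X) \V (V ◁ ⟦c⟧) = ⟦g⟧.
Proof.
rewrite rwhisk_varrow; last by eq_cell1.
rewrite -varrowA rwhisk_comp exchange rwhisk1 varrowA -lwhisk_comp -lrwhisk.
rewrite -lwhisk_varrow; last by eq_cell1.
by rewrite e_c_zigzag1 lwhisk_id varrow_idl.
Qed.

End Adjunction.
End Mates.

(** * The end as universal natural action, and its whiskered form *)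

Section Ends.
Variables (k : fieldType) (T : two_category k) (ld : left_duals T).

Lemma Arrow_ldual_map (A B : T) (X Y : cell1 T A B) (dX : left_dual X)
    (dY : left_dual Y) (f : mor X Y) :
  ⟦ldual_map dX dY f⟧
    = (dX ◁ ⟦ev dY⟧) \V ((dX ◁ ⟦f⟧) ▷ dY) \V (⟦coev dX⟧ ▷ dY).
Proof.
rewrite /ldual_map !Arrow_vcomp !Arrow_eqcell.
rewrite varrow_idl; last by eq_cell1.
rewrite varrow_idr; last by eq_cell1.
by rewrite varrow_idr; last by eq_cell1.
Qed.

(** On mates, postcomposition with the dual of [f] becomes precomposition with [f]; this is what
    turns dinaturality into naturality. *)
Lemma ldual_map_lmate (A B C : T) (X Y : cell1 T A B) (dX : left_dual X)
    (dY : left_dual Y) (f : mor X Y) (W : cell1 T C A) (V : cell1 T C B)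
    (h : mor W (dY \o1 V)) :
  (⟦ldual_map dX dY f⟧ ▷ V) \V ⟦h⟧
    = (dX ◁ ((⟦ev dY⟧ ▷ V) \V (Y ◁ ⟦h⟧) \V (⟦f⟧ ▷ W))) \V (⟦coev dX⟧ ▷ W).
Proof.
rewrite Arrow_ldual_map !rwhisk_varrow; try by eq_cell1.
rewrite !rwhisk_comp -[in LHS](lwhisk1 ⟦h⟧) -!varrowA exchange -lwhisk_comp.
rewrite -!lrwhisk [X in _ \V X]varrowA -lwhisk_varrow //.
rewrite exchange !varrowA -lwhisk_varrow; last by eq_cell1.
by rewrite varrowA.
Qed.

Variables (A B : T).

(** The two sides of the wedge equation are the mates of [f \v g Y] and of [g Y' \v (f \o2 idm W)],
    and taking mates is injective. *)
Lemma wedge_mateP (W : cell1 T A A)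
    (d : forall Y : cell1 T A B, mor W (ld Y \o1 Y))
    (g : forall Y : cell1 T A B, mor (Y \o1 W) Y) :
    (forall Y, ⟦g Y⟧ = (⟦ev (ld Y)⟧ ▷ Y) \V (Y ◁ ⟦d Y⟧)) ->
  is_wedge d <->
  forall (Y Y' : cell1 T A B) (f : mor Y Y'),
    ⟦f⟧ \V ⟦g Y⟧ = ⟦g Y'⟧ \V (⟦f⟧ ▷ W).
Proof.
move=> gE.
have dE Y : ⟦d Y⟧ = (ld Y ◁ ⟦g Y⟧) \V (⟦coev (ld Y)⟧ ▷ W).
  by rewrite gE (lunmateK (zigzag2 (left_dualP _))).
have lE Y Y' (f : mor Y Y') : (ld Y ◁ ⟦f⟧) \V ⟦d Y⟧
    = (ld Y ◁ ⟦f \v g Y⟧) \V (⟦coev (ld Y)⟧ ▷ W).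
  by rewrite dE varrowA -lwhisk_varrow // Arrow_vcomp.
have rE Y Y' (f : mor Y Y') : (⟦ldual_map (ld Y) (ld Y') f⟧ ▷ Y') \V ⟦d Y'⟧
    = (ld Y ◁ ⟦g Y' \v (f \o2 idm W)⟧) \V (⟦coev (ld Y)⟧ ▷ W).
  by rewrite ldual_map_lmate -gE Arrow_vcomp.
split=> [wd Y Y' f|ng Y Y' f].
  have /(congr1 (@Arrow _ _ _ _)) := wd Y Y' f.
  rewrite !Arrow_vcomp Arrow_lwhisk Arrow_rwhisk lE rE.
  move/(congr1 (fun a => (⟦ev (ld Y)⟧ ▷ Y') \V (Y ◁ a))).
  by rewrite !(lmateK (zigzag1 (left_dualP _))) !Arrow_vcomp.
apply: Arrow_inj.
by rewrite !Arrow_vcomp Arrow_lwhisk Arrow_rwhisk lE rE !Arrow_vcomp ng.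
Qed.

Variable L : dual_end ld A B.

(* The mate Y o L => Y of the projection L => *Y o Y. *)
Definition end_action (Y : cell1 T A B) : mor (Y \o1 L) Y.
Proof.
apply: (@of_arrow _ _ ((⟦ev (ld Y)⟧ ▷ Y) \V (Y ◁ ⟦end_pr L Y⟧))) => //.
exact: comp11m.
Defined.

Lemma Arrow_end_action (Y : cell1 T A B) :
  ⟦end_action Y⟧ = (⟦ev (ld Y)⟧ ▷ Y) \V (Y ◁ ⟦end_pr L Y⟧).
Proof. exact: Arrow_of_arrow. Qed.

Lemma end_action_natural (Y Y' : cell1 T A B) (f : mor Y Y') :
  ⟦f⟧ \V ⟦end_action Y⟧ = ⟦end_action Y'⟧ \V (⟦f⟧ ▷ L).
Proof. exact: (proj1 (wedge_mateP Arrow_end_action) (end_wedge L)). Qed.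

Lemma end_action_universal (W : cell1 T A A)
    (g : forall Y : cell1 T A B, mor (Y \o1 W) Y) :
    (forall (Y Y' : cell1 T A B) (f : mor Y Y'),
      ⟦f⟧ \V ⟦g Y⟧ = ⟦g Y'⟧ \V (⟦f⟧ ▷ W)) ->
  exists! u : mor W L, forall Y, ⟦end_action Y⟧ \V (Y ◁ ⟦u⟧) = ⟦g Y⟧.
Proof.
move=> ng.
pose d Y : mor W (ld Y \o1 Y) :=
  @of_arrow _ _ ((ld Y ◁ ⟦g Y⟧) \V (⟦coev (ld Y)⟧ ▷ W)) _ _ (comp11m W) erefl.
have dE Y : ⟦d Y⟧ = (ld Y ◁ ⟦g Y⟧) \V (⟦coev (ld Y)⟧ ▷ W).
  exact: Arrow_of_arrow.
have gE Y : ⟦g Y⟧ = (⟦ev (ld Y)⟧ ▷ Y) \V (Y ◁ ⟦d Y⟧).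
  by rewrite dE (lmateK (zigzag1 (left_dualP _))).
(* A 2-cell factors [g] through the actions exactly when it factors the mates [d] through the
   projections, so existence and uniqueness carry over from the end. *)
have uE (u : mor W L) : (forall Y, ⟦end_action Y⟧ \V (Y ◁ ⟦u⟧) = ⟦g Y⟧) <->
    (forall Y, end_pr L Y \v u = d Y).
  split=> H Y.
    apply: Arrow_inj.
    rewrite -[RHS](lunmateK (zigzag2 (left_dualP (ld Y)))) -gE -H Arrow_end_action.
    by rewrite -varrowA -lwhisk_varrow // -Arrow_vcomp (lunmateK (zigzag2 (left_dualP _))).
  rewrite gE -H Arrow_end_action Arrow_vcomp -varrowA -lwhisk_varrow //.
have [u [Hu uniq_u]] := end_universal L (proj2 (wedge_mateP gE) ng).
exists u; split; first exact/uE.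
by move=> v /uE; apply: uniq_u.
Qed.

Section Whisker.
Variables (C : T) (X : cell1 T C A).

Lemma whisker_end_exists (W : cell1 T C A)
    (g : forall Y : cell1 T A B, mor (Y \o1 W) (Y \o1 X)) :
    (forall (Y Y' : cell1 T A B) (f : mor Y Y'),
      (⟦f⟧ ▷ X) \V ⟦g Y⟧ = ⟦g Y'⟧ \V (⟦f⟧ ▷ W)) ->
  exists u : mor W (L \o1 X),
    forall Y, (⟦end_action Y⟧ ▷ X) \V (Y ◁ ⟦u⟧) = ⟦g Y⟧.
Proof.
move=> ng; pose D := ld X.
(* The target factor [X] is bent onto the source as its left dual [D], which leaves a family with
   values in [Y] itself. *)
pose e Y : mor (Y \o1 (W \o1 D)) Y :=
  @of_arrow _ _ ((Y ◁ ⟦ev D⟧) \V (⟦g Y⟧ ▷ D)) _ _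
     (esym (comp1A Y W D)) (comp1m1 Y).
have eE Y : ⟦e Y⟧ = (Y ◁ ⟦ev D⟧) \V (⟦g Y⟧ ▷ D) by exact: Arrow_of_arrow.
have ne Y Y' (f : mor Y Y') : ⟦f⟧ \V ⟦e Y⟧ = ⟦e Y'⟧ \V (⟦f⟧ ▷ (W \o1 D)).
  rewrite !eE -[⟦f⟧ in LHS]rwhisk1 varrowA exchange -varrowA -rwhisk_comp.
  rewrite -rwhisk_varrow // ng rwhisk_varrow // varrowA.
  by rewrite rwhisk_comp.
have [u' [Hu _]] := end_action_universal ne.
pose u : mor W (L \o1 X) :=
  @of_arrow _ _ ((⟦u'⟧ ▷ X) \V (W ◁ ⟦coev D⟧)) _ _ (comp1m1 W) erefl.
have uE : ⟦u⟧ = (⟦u'⟧ ▷ X) \V (W ◁ ⟦coev D⟧) by exact: Arrow_of_arrow.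
exists u => Y.
rewrite uE lwhisk_varrow; last by eq_cell1.
rewrite varrowA lrwhisk -rwhisk_varrow // Hu eE lwhisk_comp.
by rewrite (rmateK (zigzag1 (left_dualP D))).
Qed.

(** The mates [W \o1 D] to [L] of [u] and [v] induce the same natural family, so they agree by
    uniqueness in the universal property of the end. *)
Lemma whisker_end_inj (W : cell1 T C A) (u v : mor W (L \o1 X)) :
    (forall Y, (⟦end_action Y⟧ ▷ X) \V (Y ◁ ⟦u⟧)
             = (⟦end_action Y⟧ ▷ X) \V (Y ◁ ⟦v⟧)) ->
  u = v.
Proof.
move=> uv; pose D := ld X.
pose m (w : mor W (L \o1 X)) : mor (W \o1 D) L :=
  @of_arrow _ _ ((L ◁ ⟦ev D⟧) \V (⟦w⟧ ▷ D)) _ _ erefl (comp1m1 L).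
have mE w : ⟦m w⟧ = (L ◁ ⟦ev D⟧) \V (⟦w⟧ ▷ D) by exact: Arrow_of_arrow.
have amE w Y : ⟦end_action Y⟧ \V (Y ◁ ⟦m w⟧)
    = (Y ◁ ⟦ev D⟧) \V (((⟦end_action Y⟧ ▷ X) \V (Y ◁ ⟦w⟧)) ▷ D).
  rewrite mE lwhisk_varrow; last by eq_cell1.
  rewrite rwhisk_varrow; last by eq_cell1.
  rewrite !varrowA lwhisk_comp -[⟦end_action Y⟧ in LHS]rwhisk1.
  by rewrite exchange rwhisk_comp lrwhisk.
have m_inj : m u = m v.
  pose g Y : mor (Y \o1 (W \o1 D)) Y :=
    @of_arrow _ _ (⟦end_action Y⟧ \V (Y ◁ ⟦m u⟧)) _ _ erefl erefl.
  have gE Y : ⟦g Y⟧ = ⟦end_action Y⟧ \V (Y ◁ ⟦m u⟧) by exact: Arrow_of_arrow.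
  have ng Y Y' (f : mor Y Y') : ⟦f⟧ \V ⟦g Y⟧ = ⟦g Y'⟧ \V (⟦f⟧ ▷ (W \o1 D)).
    by rewrite !gE varrowA end_action_natural -!varrowA exchange.
  have [w [_ w_uniq]] := end_action_universal ng.
  rewrite -(w_uniq (m u)) => [|Y]; last by rewrite gE.
  by apply: w_uniq => Y; rewrite gE !amE uv.
apply: Arrow_inj.
by rewrite -[LHS](rmateK (zigzag1 (left_dualP D))) -mE m_inj mE (rmateK (zigzag1 (left_dualP D))).
Qed.

End Whisker.
End Ends.

(** * Half braidings: existence, naturality, unit, composition, inverse *)

Section HalfBraiding.
Variables (k : fieldType) (T : two_category k) (ld : left_duals T).
Variable B : T.
Variable L : forall A : T, dual_end ld A B.

Definition is_half_braiding (A C : T) (X : cell1 T C A)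
    (t : mor (X \o1 L C) (L A \o1 X)) : Prop :=
  forall Y : cell1 T A B,
    (⟦end_action (L A) Y⟧ ▷ X) \V (Y ◁ ⟦t⟧) = ⟦end_action (L C) (Y \o1 X)⟧.

Lemma half_braiding_exists (A C : T) (X : cell1 T C A) :
  exists t : mor (X \o1 L C) (L A \o1 X), is_half_braiding t.
Proof.
(* The action on [Y \o1 X] with its source rebracketed; it is natural in [Y] because whiskering by
   [X] turns [f] into a 2-cell between such composites. *)
pose g (Y : cell1 T A B) : mor (Y \o1 (X \o1 L C)) (Y \o1 X) :=
  @of_arrow _ _ ⟦end_action (L C) (Y \o1 X)⟧ _ _ (esym (comp1A Y X (L C))) erefl.
have gE Y : ⟦g Y⟧ = ⟦end_action (L C) (Y \o1 X)⟧ by exact: Arrow_of_arrow.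
have [|t tE] := @whisker_end_exists _ _ _ _ _ (L A) _ X _ g.
  by move=> Y Y' f; rewrite !gE -Arrow_rwhisk end_action_natural -rwhisk_comp.
by exists t => Y; rewrite tE gE.
Qed.

(** Both sides agree after composing with the actions, by naturality of the action along [f]
    whiskered by [Y]; [whisker_end_inj] then applies. *)
Lemma half_braiding_natural (A C : T) (X X' : cell1 T C A) (f : mor X X')
    (t : mor (X \o1 L C) (L A \o1 X)) (t' : mor (X' \o1 L C) (L A \o1 X')) :
    is_half_braiding t -> is_half_braiding t' ->
  (L A ◁ ⟦f⟧) \V ⟦t⟧ = ⟦t'⟧ \V (⟦f⟧ ▷ L C).
Proof.
move=> tE t'E; rewrite -Arrow_lwhisk -Arrow_rwhisk -!Arrow_vcomp; congr Arrow.
apply: whisker_end_inj => Y.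
rewrite !Arrow_vcomp !lwhisk_varrow // !varrowA t'E Arrow_lwhisk lwhisk_comp.
rewrite exchange -varrowA tE -Arrow_lwhisk end_action_natural.
by rewrite Arrow_rwhisk lrwhisk.
Qed.

Lemma end_action_eq (A : T) (Y Y' : cell1 T A B) :
  Y = Y' -> ⟦end_action (L A) Y⟧ = ⟦end_action (L A) Y'⟧.
Proof. by move->. Qed.

(** The identity satisfies the same defining equations because [Y \o1 unit1 A = Y] strictly;
    uniqueness does the rest. *)
Lemma half_braiding_unit (A : T) (t : mor (unit1 A \o1 L A) (L A \o1 unit1 A)) :
  is_half_braiding t -> ⟦t⟧ = ⟦idm (L A)⟧.
Proof.
move=> tE.
pose v := @of_arrow _ _ ⟦idm (L A)⟧ _ _
            (esym (comp11m (L A))) (esym (comp1m1 (L A))).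
have vE : ⟦v⟧ = ⟦idm (L A)⟧ by exact: Arrow_of_arrow.
rewrite -vE; congr Arrow; apply: whisker_end_inj => Y.
by rewrite tE vE lwhisk_id rwhisk1 varrow_idr // (end_action_eq (comp1m1 Y)).
Qed.

(** The right side satisfies the equations defining [tXY]: [tX] turns the action on [Z] into that on
    [Z \o1 X], and [tY] turns this into that on [(Z \o1 X) \o1 Y]. *)
Lemma half_braiding_comp (A C D : T) (X : cell1 T C A) (Y : cell1 T D C)
    (tX : mor (X \o1 L C) (L A \o1 X)) (tY : mor (Y \o1 L D) (L C \o1 Y))
    (tXY : mor ((X \o1 Y) \o1 L D) (L A \o1 (X \o1 Y))) :
    is_half_braiding tX -> is_half_braiding tY -> is_half_braiding tXY ->
  ⟦tXY⟧ = (⟦tX⟧ ▷ Y) \V (X ◁ ⟦tY⟧).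
Proof.
move=> tXE tYE tXYE.
pose v := @of_arrow _ _ ((⟦tX⟧ ▷ Y) \V (X ◁ ⟦tY⟧)) _ _
            (comp1A X Y (L D)) (esym (comp1A (L A) X Y)).
have vE : ⟦v⟧ = (⟦tX⟧ ▷ Y) \V (X ◁ ⟦tY⟧) by exact: Arrow_of_arrow.
rewrite -vE; congr Arrow; apply: whisker_end_inj => Z.
rewrite tXYE vE lwhisk_varrow; last by eq_cell1.
rewrite varrowA -rwhisk_comp lrwhisk -rwhisk_varrow; last by eq_cell1.
by rewrite tXE lwhisk_comp tYE (end_action_eq (comp1A Z X Y)).
Qed.

(* The inverse is the half braiding with the right dual of X, bent around. *)
Lemma half_braiding_iso (A C : T) (X : cell1 T C A) (dX : right_dual X)
    (t : mor (X \o1 L C) (L A \o1 X)) : is_half_braiding t -> is_iso t.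
Proof.
case: dX => D e c /= dualP tE.
(* Half braidings on the composites let [t] merge with [tD]; those on the units, being identities,
   let [e] and [c] slide past the end. *)
have [tD tDE] := half_braiding_exists D.
have [tXD tXDE] := half_braiding_exists (X \o1 D).
have [tDX tDXE] := half_braiding_exists (D \o1 X).
have [tA tAE] := half_braiding_exists (unit1 A).
have [tC tCE] := half_braiding_exists (unit1 C).
pose s : mor (L A \o1 X) (X \o1 L C) :=
  @of_arrow _ _ (((X \o1 L C) ◁ ⟦e⟧) \V ((X ◁ ⟦tD⟧) ▷ X)
                   \V (⟦c⟧ ▷ (L A \o1 X))) _ _ (comp11m _) (comp1m1 _).
have sE : ⟦s⟧ = ((X \o1 L C) ◁ ⟦e⟧) \V ((X ◁ ⟦tD⟧) ▷ X) \V (⟦c⟧ ▷ (L A \o1 X)).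
  exact: Arrow_of_arrow.
exists s; split; apply: Arrow_inj; rewrite Arrow_vcomp sE.
  have bend : ((X ◁ ⟦tD⟧) ▷ X) \V ((X \o1 D) ◁ ⟦t⟧) = X ◁ ⟦tDX⟧.
    rewrite (half_braiding_comp tDE tE tDXE) -lwhisk_comp -lrwhisk.
    by rewrite -lwhisk_varrow //; eq_cell1.
  have slide : ((X \o1 L C) ◁ ⟦e⟧) \V (X ◁ ⟦tDX⟧) = (X ◁ ⟦e⟧) ▷ L C.
    rewrite -lwhisk_comp -lwhisk_varrow // (half_braiding_natural e tDXE tCE).
    by rewrite (half_braiding_unit tCE) varrow_idl ?lrwhisk; last by eq_cell1.
  (* Exchanging [c] and [t] puts [t] next to [tD]; after merging and sliding, a triangle identity is
     left. *)
  rewrite -varrowA -[⟦t⟧]lwhisk1 exchange varrowA -(varrowA _ _ (_ ◁ _)) bend slide.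
  rewrite -rwhisk_comp -rwhisk_varrow; last by eq_cell1.
  by rewrite (zigzag2 dualP) rwhisk_id.
have bend : (⟦t⟧ ▷ (D \o1 X)) \V ((X ◁ ⟦tD⟧) ▷ X) = ⟦tXD⟧ ▷ X.
  rewrite (half_braiding_comp tE tDE tXDE) -rwhisk_comp.
  by rewrite -rwhisk_varrow //; eq_cell1.
have slide : (⟦tXD⟧ ▷ X) \V (⟦c⟧ ▷ (L A \o1 X)) = (L A ◁ ⟦c⟧) ▷ X.
  rewrite -rwhisk_comp -rwhisk_varrow // -(half_braiding_natural c tAE tXDE).
  by rewrite (half_braiding_unit tAE) varrow_idr //; eq_cell1.
rewrite !varrowA -[⟦t⟧]rwhisk1 exchange -(varrowA _ _ (_ ▷ X)) bend -varrowA slide.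
rewrite -lwhisk_comp -lrwhisk -lwhisk_varrow; last by eq_cell1.
by rewrite (zigzag2 dualP) lwhisk_id.
Qed.

End HalfBraiding.

(** * Left duals of composites and the projection formula *)

Lemma Arrow_coev_comp (k : fieldType) (T : two_category k) (A B C : T)
    (Y : cell1 T B C) (X : cell1 T A B) (dY : left_dual Y) (dX : left_dual X) :
  ⟦coev_comp dY dX⟧ = (dX ◁ (⟦coev dY⟧ ▷ X)) \V ⟦coev dX⟧.
Proof.
rewrite /coev_comp !Arrow_vcomp !Arrow_eqcell.
rewrite varrow_idl; last by eq_cell1.
by rewrite varrow_idr; last by eq_cell1.
Qed.

Lemma Arrow_ldual_comp (k : fieldType) (T : two_category k) (A B C : T)
    (Y : cell1 T B C) (X : cell1 T A B) (dY : left_dual Y) (dX : left_dual X)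
    (dYX : left_dual (Y \o1 X)) :
  ⟦ldual_comp dY dX dYX⟧
    = ((dX \o1 dY) ◁ ⟦ev dYX⟧) \V (⟦coev_comp dY dX⟧ ▷ dYX).
Proof.
rewrite /ldual_comp; move: (coev_comp dY dX) => c; rewrite !Arrow_vcomp !Arrow_eqcell.
rewrite varrow_idl; last by eq_cell1.
rewrite varrow_idr; last by eq_cell1.
by rewrite varrow_idr; last by eq_cell1.
Qed.

(** The canonical 2-cell is the mate of [ev dYX] across the duality of [Y \o1 X] with [dX \o1 dY],
    whose evaluation nests [ev dX] inside [ev dY]; mating back returns [ev dYX]. *)
Lemma ev_ldual_comp (k : fieldType) (T : two_category k) (A B C : T)
    (Y : cell1 T B C) (X : cell1 T A B) (dY : left_dual Y) (dX : left_dual X)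
    (dYX : left_dual (Y \o1 X)) :
  ⟦ev dY⟧ \V (Y ◁ ⟦ev dX⟧ ▷ dY) \V ((Y \o1 X) ◁ ⟦ldual_comp dY dX dYX⟧)
    = ⟦ev dYX⟧.
Proof.
have eS : (Y \o1 (X \o1 dX)) \o1 dY = (Y \o1 X) \o1 (dX \o1 dY) by rewrite !comp1A.
pose e : mor ((Y \o1 X) \o1 (dX \o1 dY)) (unit1 C) :=
  @of_arrow _ _ (⟦ev dY⟧ \V (Y ◁ ⟦ev dX⟧ ▷ dY)) _ _ (etrans (comp1A Y _ dY) eS) erefl.
have eE : ⟦e⟧ = ⟦ev dY⟧ \V (Y ◁ ⟦ev dX⟧ ▷ dY) by exact: Arrow_of_arrow.
have zz : (⟦e⟧ ▷ (Y \o1 X)) \V ((Y \o1 X) ◁ ⟦coev_comp dY dX⟧) = ⟦idm (Y \o1 X)⟧.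
  (* [ev dX] and [coev dY] act on disjoint factors, so they commute; this splits the composite
     triangle identity into those of [Y] and [X]. *)
  have slide : ((Y ◁ ⟦ev dX⟧ ▷ dY) ▷ (Y \o1 X))
                 \V ((Y \o1 X) ◁ dX ◁ (⟦coev dY⟧ ▷ X))
               = (Y ◁ ⟦coev dY⟧ ▷ X) \V (Y ◁ ⟦ev dX⟧ ▷ X).
    rewrite -lrwhisk rwhisk_comp -lwhisk_comp -lwhisk_varrow; last by eq_cell1.
    rewrite lwhisk_comp -Arrow_rwhisk (comp1A dY Y X) exchange lwhisk1.
    by rewrite -(rwhisk_comp _ (unit1 B) X) rwhisk1 lwhisk_varrow.
  rewrite eE rwhisk_varrow; last by eq_cell1.
  rewrite Arrow_coev_comp lwhisk_varrow; last by eq_cell1.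
  rewrite !varrowA -(varrowA _ _ (_ ◁ _ ◁ _)) slide varrowA.
  rewrite -rwhisk_comp lrwhisk -rwhisk_varrow; last by eq_cell1.
  rewrite (zigzag1 (left_dualP dY)) rwhisk_id -varrowA -lwhisk_comp.
  rewrite -lwhisk_varrow; last by eq_cell1.
  by rewrite (zigzag1 (left_dualP dX)) lwhisk_id varrow_idl.
have := lmateK zz (ev dYX).
by rewrite -Arrow_ldual_comp rwhisk1 eE.
Qed.

Lemma Arrow_ev_end_pr (k : fieldType) (T : two_category k) (ld : left_duals T)
    (A B C : T) (L : dual_end ld C B) (X : cell1 T C A) (Y : cell1 T A B) :
  ⟦ev_end_pr L X Y⟧
    = (⟦ev (ld C A X)⟧ ▷ ((ld A B Y \o1 Y) \o1 X))
        \V (X ◁ (⟦ldual_comp (ld A B Y) (ld C A X) (ld C B (Y \o1 X))⟧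
                  ▷ (Y \o1 X)))
        \V (X ◁ ⟦end_pr L (Y \o1 X)⟧).
Proof.
rewrite /ev_end_pr; move: (ldual_comp _ _ _) => c; rewrite !Arrow_vcomp !Arrow_eqcell.
rewrite varrow_idl; last by eq_cell1.
by rewrite varrow_idr; last by eq_cell1.
Qed.

(** Once [dY] is removed by adjunction, both sides become the action on [Y \o1 X]: the left by the
    equation defining [t], the right because [ev_ldual_comp] reassembles the evaluation of the
    composite. *)
Lemma half_braiding_end_pr (k : fieldType) (T : two_category k)
    (ld : left_duals T) (B : T) (L : forall A : T, dual_end ld A B)
    (A C : T) (X : cell1 T C A) (t : mor (X \o1 L C) (L A \o1 X))
    (Y : cell1 T A B) :
  is_half_braiding t -> (⟦end_pr (L A) Y⟧ ▷ X) \V ⟦t⟧ = ⟦ev_end_pr (L C) X Y⟧.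
Proof.
move=> tE; set dY := ld A B Y.
have tYX : (dY \o1 Y) \o1 X = dY \o1 (Y \o1 X) by rewrite comp1A.
pose f : mor (X \o1 L C) (dY \o1 (Y \o1 X)) :=
  @of_arrow _ _ ((⟦end_pr (L A) Y⟧ ▷ X) \V ⟦t⟧) _ _ erefl tYX.
pose g : mor (X \o1 L C) (dY \o1 (Y \o1 X)) :=
  @of_arrow _ _ ⟦ev_end_pr (L C) X Y⟧ _ _ erefl tYX.
have fE : ⟦f⟧ = (⟦end_pr (L A) Y⟧ ▷ X) \V ⟦t⟧ by exact: Arrow_of_arrow.
have gE : ⟦g⟧ = ⟦ev_end_pr (L C) X Y⟧ by exact: Arrow_of_arrow.
have dz2 := zigzag2 (left_dualP dY).
rewrite -fE -gE -(lunmateK dz2 f) -(lunmateK dz2 g).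
congr ((dY ◁ _) \V _); rewrite fE gE.
have -> : (⟦ev dY⟧ ▷ (Y \o1 X)) \V (Y ◁ (⟦end_pr (L A) Y⟧ ▷ X \V ⟦t⟧))
    = ⟦end_action (L C) (Y \o1 X)⟧.
  rewrite -tE Arrow_end_action lwhisk_varrow // varrowA rwhisk_varrow; last by eq_cell1.
  by rewrite rwhisk_comp lrwhisk.
rewrite Arrow_end_action Arrow_ev_end_pr.
rewrite -(ev_ldual_comp dY (ld C A X) (ld C B (Y \o1 X))).
rewrite !rwhisk_varrow; try by eq_cell1.
rewrite !lwhisk_varrow; try by eq_cell1.
by rewrite !varrowA -!lwhisk_comp -!lrwhisk !rwhisk_comp comp1A.
Qed.

(** * Assembling the inverse half braidings into an object of the center *)

Theorem proposition5p1 (k : closedFieldType) (T : two_category k)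
    (finT : finite_two_category T) (ld : left_duals T)
    (L : forall A B : T, dual_end ld A B) :
  exists sigma : forall (B A C : T) (X : cell1 T C A),
      mor (L A B \o1 X) (X \o1 L C B),
    (forall A B C : T,
      [/\ forall X : cell1 T C A, is_iso (sigma B A C X),
          forall (X X' : cell1 T C A) (f : mor X X'),
            (f \o2 idm (L C B)) \v sigma B A C X
              = sigma B A C X' \v (idm (L A B) \o2 f)
        & forall (X : cell1 T C A) (Y : cell1 T A B),
            end_pr (L A B) Y \o2 idm X
              = ev_end_pr (L C B) X Y \v sigma B A C X]) /\
    (forall B : T,
      is_center_object (fun A : T => L A B)
                       (fun (C A : T) (X : cell1 T C A) => sigma B A C X)).
Proof.
have exists_inv (B A C : T) (X : cell1 T C A) :
    exists s : mor (L A B \o1 X) (X \o1 L C B), exists t,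
      [/\ @is_half_braiding _ _ _ B (L^~ B) A C X t,
          s \v t = idm _ & t \v s = idm _].
  have [t tE] := half_braiding_exists (L^~ B) X.
  have [_ [dX]] := f2_rigid finT X.
  by have [s [st ts]] := half_braiding_iso dX tE; exists s, t.
(* [sigma] is picked by choice; each property below is transferred from a half braiding [t] inverse
   to it. *)
pose sigma B A C X := sval (cid (exists_inv B A C X)).
have sigmaP B A C X : exists t,
    [/\ @is_half_braiding _ _ _ B (L^~ B) A C X t,
        ⟦sigma B A C X⟧ \V ⟦t⟧ = ⟦idm (X \o1 L C B)⟧
      & ⟦t⟧ \V ⟦sigma B A C X⟧ = ⟦idm (L A B \o1 X)⟧].
  have [t [tE st ts]] := svalP (cid (exists_inv B A C X)).
  by exists t; split=> //; rewrite -Arrow_vcomp (st, ts).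
have sigma_iso B A C X : is_iso (sigma B A C X).
  have [t [tE st ts]] := sigmaP B A C X.
  by exists t; split; apply: Arrow_inj; rewrite Arrow_vcomp.
have sigma_natural B A C (X X' : cell1 T C A) (f : mor X X') :
    (f \o2 idm (L C B)) \v sigma B A C X = sigma B A C X' \v (idm (L A B) \o2 f).
  have [t [tE st ts]] := sigmaP B A C X.
  have [t' [tE' st' ts']] := sigmaP B A C X'.
  apply: Arrow_inj; rewrite !Arrow_vcomp Arrow_lwhisk Arrow_rwhisk.
  (* [sigma] and [t'] for [X'] are inserted on the left; naturality of [t] then lets [t] cancel
     against [sigma] for [X]. *)
  rewrite -[LHS](varrow_idl (X := X' \o1 L C B)) // -st' -varrowA.
  rewrite [X in _ \V X = _]varrowA -(half_braiding_natural f tE tE').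
  by rewrite -[X in _ \V X = _]varrowA ts varrow_idr.
exists sigma; split=> [A B C|B].
  split=> [//|//|X Y]; have [t [tE st ts]] := sigmaP B A C X.
  apply: Arrow_inj; rewrite Arrow_vcomp Arrow_rwhisk -(half_braiding_end_pr _ tE).
  by rewrite -varrowA ts varrow_idr.
split=> [//|//|A|A C D X Y].
  (* The half braiding on the unit is the identity, hence so is its inverse. *)
  have [t [tE st ts]] := sigmaP B A A (unit1 A).
  apply: Arrow_inj; rewrite Arrow_eqcell -[LHS](varrow_idl (X := L A B)); last by eq_cell1.
  by rewrite -(half_braiding_unit tE) ts !comp1m1.
have [tX [tXE stX tsX]] := sigmaP B D C X.
have [tY [tYE stY tsY]] := sigmaP B C A Y.
have [t [tE st ts]] := sigmaP B D A (X \o1 Y).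
apply: Arrow_inj; rewrite !Arrow_vcomp !Arrow_eqcell Arrow_lwhisk Arrow_rwhisk.
set r := RHS.
have rE : r = (X ◁ ⟦sigma B C A Y⟧) \V (⟦sigma B D C X⟧ ▷ Y).
  rewrite /r varrow_idl; last by eq_cell1.
  rewrite varrow_idr; last by eq_cell1.
  by rewrite varrow_idr; last by eq_cell1.
(* With [sigma] and [t] for [X \o1 Y] inserted on the left, [t] expands into [tX] and [tY], which
   cancel against the inverses for [Y] and then for [X]. *)
rewrite rE -[RHS](varrow_idl (X := (X \o1 Y) \o1 L A B)); last by eq_cell1.
rewrite -st (half_braiding_comp tXE tYE tE) -!varrowA.
rewrite [X in _ \V (_ \V X)]varrowA -lwhisk_varrow // tsY lwhisk_id.
rewrite varrow_idl; last by eq_cell1.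
rewrite -rwhisk_varrow // tsX rwhisk_id varrow_idr //.
by eq_cell1.
Qed.
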